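(* Let $k\ge2$. Every (possibly randomized and not necessarily fair) online algorithm RAND for Edge-$k$-Coloring(Tree) satisfies $C_{\mathrm{RAND}}^{\text{Tree}}(k)\le\frac{k}{k+1}$.
   Context: Online dual edge coloring, Edge-$k$-Coloring: a number $k$ of colors $1,\dots,k$ is given. The edges of a simple graph arrive one by one, each specified by its two endpoints. Upon arrival, an edge must irrevocably either be colored with one of the $k$ colors, such that no two adjacent (sharing an endpoint) colored edges receive the same color, or be rejected. The goal is to color as many edges as possible. Edge-$k$-Coloring(Tree) denotes the restriction to inputs whose graph is a tree. Competitive ratio: for an input sequence $\sigma$, let $E[\mathrm{RAND}(\sigma)]$ be the expected number of edges colored and $\mathrm{OPT}(\sigma)$ the maximum number of edges of the input graph that can be properly colored with $k$ colors. RAND is $C$-competitive if there is a constant $b$ with $E[\mathrm{RAND}(\sigma)]\ge C\cdot\mathrm{OPT}(\sigma)-b$ for all inputs $\sigma$; the competitive ratio $C_{\mathrm{RAND}}^{\text{Tree}}(k)$ is the supremum of all such $C$. *)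

(* Defs.v *)
From HB Require Import structures.
From mathcomp Require Import all_boot all_order all_algebra finmap.
From mathcomp Require Import all_classical all_reals all_analysis.

Set Implicit Arguments.
Unset Strict Implicit.
Unset Printing Implicit Defensive.

Import Order.TTheory GRing.Theory Num.Theory.

Local Open Scope classical_set_scope.
Local Open Scope ring_scope.

(* An edge is the unordered pair of its endpoints; vertices are named by
   natural numbers.  That an edge has exactly two endpoints is imposed in
   [simple_input]. *)
Definition edge : Type := {fset nat}.

Definition simple_input (s : seq edge) : bool :=
  uniq s && all (fun e : edge => #|` e| == 2%N) s.

Definition vertex_of (s : seq edge) (v : nat) : bool :=
  has (fun e : edge => v \in e) s.

Definition adj (s : seq edge) : rel nat := fun u v => [fset u; v]%fset \in s.

Definition connected_input (s : seq edge) : Prop :=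
  forall u v : nat, vertex_of s u -> vertex_of s v ->
    exists2 p : seq nat, path (adj s) u p & last u p = v.

(* A closed walk u, v, u along a single edge is a [ucycle] of size 2 but not a
   cycle of the graph. *)
Definition acyclic_input (s : seq edge) : Prop :=
  forall c : seq nat, ucycle (adj s) c -> (size c < 3)%N.

(* Only the whole input has to be a tree: its prefixes may be arbitrary
   forests.  The empty sequence stands for the tree with a single vertex. *)
Definition tree_input (s : seq edge) : Prop :=
  [/\ simple_input s, connected_input s & acyclic_input s].

(* A partial coloring of the edges of s, indexed by arrival time; [None] means
   that the edge is not colored. *)
Definition coloring (k : nat) (s : seq edge) : finType :=
  {ffun 'I_(size s) -> option 'I_k}.

Definition edge_at (s : seq edge) (i : 'I_(size s)) : edge :=
  tnth (in_tuple s) i.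

Definition adjacent_edges (e f : edge) : bool := (e `&` f != fset0)%fset.

Definition proper_coloring (k : nat) (s : seq edge) (c : coloring k s) : Prop :=
  forall i j : 'I_(size s), i != j ->
    adjacent_edges (edge_at i) (edge_at j) -> c i != None -> c i != c j.

Definition num_colored (k : nat) (s : seq edge) (c : coloring k s) : nat :=
  #|[pred i | c i != None]|.

Definition OPT (k : nat) (s : seq edge) : nat :=
  (\max_(c : coloring k s | `[< proper_coloring c >]) num_colored c)%N.

(* The edges that have already arrived (oldest first) and the new edge
   determine the decision: a color, or [None] for rejection.  The past
   decisions need not be given, being themselves functions of the past edges. *)
Definition online_algorithm (k : nat) : Type :=
  seq edge -> edge -> option 'I_k.

Definition run (k : nat) (A : online_algorithm k) (s : seq edge) :
    coloring k s :=
  [ffun i : 'I_(size s) => A (take i s) (edge_at i)].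

Definition solves_tree (k : nat) (A : online_algorithm k) : Prop :=
  forall s : seq edge, tree_input s -> proper_coloring (run A s).

(* A randomized algorithm is a random deterministic algorithm: w is the
   outcome of all its random choices. *)
Record randomized_tree_algorithm (R : realType) (k : nat) := RandTreeAlg {
  rand_display : measure_display;
  rand_space : measurableType rand_display;
  rand_prob : probability rand_space R;
  rand_alg : rand_space -> online_algorithm k;
  rand_alg_measurable : forall (s : seq edge) (e : edge) (o : option 'I_k),
    measurable [set w | rand_alg w s e = o];
  rand_alg_solves : forall w : rand_space, solves_tree (rand_alg w)
}.

Definition expected_colored (R : realType) (k : nat)
    (A : randomized_tree_algorithm R k) (s : seq edge) : \bar R :=
  'E_(rand_prob A)[fun w => (num_colored (run (rand_alg w) s))%:R].

Definition competitive (R : realType) (k : nat)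
    (A : randomized_tree_algorithm R k) (C : R) : Prop :=
  exists b : R, forall s : seq edge, tree_input s ->
    ((C * (OPT k s)%:R - b)%:E <= expected_colored A s)%E.

Definition competitive_ratio (R : realType) (k : nat)
    (A : randomized_tree_algorithm R k) : \bar R :=
  ereal_sup [set C%:E | C in competitive A].

(* Main.v *)
Require Import Defs.
From HB Require Import structures.
From mathcomp Require Import all_boot all_order all_algebra finmap.
From mathcomp Require Import all_classical all_reals all_analysis.
From mathcomp Require Import measurable_realfun.
From mathcomp Require Import zify ring lra.

Import Order.TTheory GRing.Theory Num.Theory.
Local Open Scope ring_scope.

(* The adversary reveals the complete k-ary tree level by level. It stops after
   some level and then attaches k extra leaves to every vertex that has
   grandchildren. Each vertex with children now has k leaf children, so coloring
   exactly the edges to these leaves is proper. The algorithm instead wastes, at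
   each vertex with grandchildren, the capacity spent on the tree edges there:
   an edge colored early takes part in two such stars.
   Let S d be the expected number of colored edges in the first d levels, a d
   the number of edges there, alpha = k / (k + 1) and Z d = S d - alpha * a d.
   Summing the degree constraints over one level gives Z (d+2) <= Z d, whereas
   C-competitiveness on the input that stops at level d+2 gives
   Z (d+2) >= Z (d+1) + Z d + (C - alpha) * a (d+2) - O(1).
   Hence Z is eventually negative, but then its absolute value grows at most
   like the Fibonacci numbers, too slowly for the k^d term when C > alpha. *)

(** * Trees grown by attaching one vertex at a time *)

(* The i-th edge attaches the new vertex i+1 to the vertex par i. *)
Definition grown (par : nat -> nat) (n : nat) : seq edge :=
  [seq [fset par i; i.+1]%fset | i <- iota 0 n].

Lemma size_grown par n : size (grown par n) = n.
Proof. by rewrite size_map size_iota. Qed.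

Lemma nth_grown par n i : (i < n)%N ->
  nth fset0 (grown par n) i = [fset par i; i.+1]%fset.
Proof. by move=> lt_in; rewrite (nth_map 0%N) ?size_iota // nth_iota. Qed.

Lemma take_grown par n i : (i <= n)%N -> take i (grown par n) = grown par i.
Proof. by move=> le_in; rewrite -map_take take_iota (minn_idPl le_in). Qed.

Lemma eq_grown par par' n : (forall i, (i < n)%N -> par i = par' i) ->
  grown par n = grown par' n.
Proof.
move=> eq_par; apply/eq_in_map => i; rewrite mem_iota add0n => /andP[_ lt_in].
by rewrite eq_par.
Qed.

Section GrownTree.
Context (par : nat -> nat) (n : nat).
Hypothesis par_le : forall i, (i <= n)%N -> (par i <= i)%N.

(** As [par i <= i], the larger endpoint [i.+1] determines the edge. *)
Lemma grown_edge_inj {u v i : nat} : (i <= n)%N -> (u < v)%N ->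
  [fset u; v]%fset = [fset par i; i.+1]%fset -> u = par i /\ v = i.+1.
Proof.
move=> /par_le le_i lt_uv E.
have := fset21 u v; have := fset22 u v; have := fset22 (par i) i.+1.
rewrite E -{1}E !inE.
move=> /orP[]/eqP H1 /orP[]/eqP H2 /orP[]/eqP H3; lia.
Qed.

Lemma adj_grown_lt {u v : nat} : (u < v)%N -> adj (grown par n) u v ->
  u = par v.-1.
Proof.
move=> lt_uv /mapP[i]; rewrite mem_iota add0n => /andP[_ lt_in].
by move=> /(grown_edge_inj (ltnW lt_in) lt_uv)[-> ->].
Qed.

Lemma adj_sym s : symmetric (adj s).
Proof. by move=> u v; rewrite /adj fsetUC. Qed.

Lemma adj_grown_neq {u v : nat} : adj (grown par n) u v -> u != v.
Proof.
move=> /mapP[i]; rewrite mem_iota add0n => /andP[_ lt_in] E.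
have := par_le _ (ltnW lt_in); apply: contraTneq => eq_uv; move: E.
rewrite -eq_uv fsetUid => E.
have := fset21 (par i) i.+1; have := fset22 (par i) i.+1.
by rewrite -E !inE => /eqP <- /eqP ->; rewrite ltnn.
Qed.

Lemma grown_simple : simple_input (grown par n).
Proof.
apply/andP; split.
  rewrite map_inj_in_uniq ?iota_uniq // => i j; rewrite !mem_iota !add0n /=.
  move=> lt_in lt_jn /(grown_edge_inj (ltnW lt_jn) _)[]; last by move=> _ [].
  by rewrite ltnS par_le // ltnW.
apply/allP => e /mapP[i]; rewrite mem_iota add0n => /andP[_ lt_in] ->.
by rewrite cardfs2 neq_ltn ltnS par_le // ltnW.
Qed.

Lemma grown_vertex (v : nat) : vertex_of (grown par n) v -> (v <= n)%N.
Proof.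
case/hasP=> e /mapP[i + ->]; rewrite mem_iota add0n !inE => /andP[_ lt_in].
by have := par_le _ (ltnW lt_in); move=> + /orP[]/eqP ->; lia.
Qed.

Lemma grown_path_to_root (v : nat) : (v <= n)%N ->
  exists2 p, path (adj (grown par n)) v p & last v p = 0%N.
Proof.
elim/ltn_ind: v => -[|v] IH le_vn; first by exists [::].
have le_par := par_le _ (ltnW le_vn).
have [||p path_p last_p] := IH (par v) _ _; [lia|lia|].
exists (par v :: p) => //=; rewrite path_p andbT adj_sym.
by apply/mapP; exists v; rewrite // mem_iota.
Qed.

Lemma grown_connected : connected_input (grown par n).
Proof.
move=> u v /grown_vertex le_un /grown_vertex le_vn.
have [p path_p last_p] := grown_path_to_root _ le_un.
have [q path_q last_q] := grown_path_to_root _ le_vn.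
(* Walk from [u] to the root 0, then back along the path from [v]; [belast] drops the root so that
   it is not repeated. *)
exists (p ++ rev (belast v q)).
  rewrite cat_path path_p last_p -last_q rev_path.
  by rewrite (eq_path (e' := adj (grown par n))) // => x y; rewrite adj_sym.
rewrite last_cat last_p; case: q last_q {path_q} => [/= -> //|w q] _.
by rewrite /= rev_cons last_rcons.
Qed.

(* The largest vertex of a cycle would have two distinct smaller neighbors,
   but its only smaller neighbor is its parent. *)
Lemma grown_acyclic : acyclic_input (grown par n).
Proof.
move=> c cyc_c; rewrite ltnNge; apply/negP => size_c.
have ex_c : exists x, x \in c by case: (c) size_c => // x ?; exists x;
  exact: mem_head.
have bnd_c x : x \in c -> (x <= \max_(y <- c) y)%N.
  by move=> x_c; apply: leq_bigmax_seq.
have [M M_c M_max] := ex_maxnP ex_c bnd_c.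
have [i c' rot_c] := rot_to M_c.
have lt_M x : x \in c' -> adj (grown par n) M x -> x = par M.-1.
  move=> x_c' adj_Mx; apply: adj_grown_lt; last by rewrite adj_sym.
  rewrite ltn_neqAle eq_sym adj_grown_neq //=.
  by apply: M_max; rewrite -(mem_rot i) rot_c inE x_c' orbT.
move: cyc_c; rewrite -(rot_ucycle i) rot_c /ucycle.
move: size_c; rewrite -(size_rot i) rot_c.
case: c' lt_M {rot_c} => [|x [|y c']] //= lt_M _
  /andP[/andP[adj_Mx /andP[_ +]]].
rewrite rcons_path => /andP[_ adj_lM] /and3P[_ + _].
rewrite (lt_M x) ?mem_head // -(lt_M (last y c')) ?mem_last //.
- by rewrite inE mem_last orbT.
- by rewrite adj_sym.
Qed.

Lemma grown_tree : tree_input (grown par n).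
Proof.
by split; [exact: grown_simple|exact: grown_connected|exact: grown_acyclic].
Qed.

End GrownTree.

(** * Degree constraints on proper colorings *)

Definition colored {k : nat} (A : online_algorithm k) (s : seq edge) (i : nat) :
    bool :=
  A (take i s) (nth fset0 s i) != None.

Lemma num_colored_run {k} (A : online_algorithm k) (s : seq edge) :
  num_colored (run A s) = (\sum_(i < size s) colored A s i)%N.
Proof.
rewrite /num_colored -sum1_card big_mkcond; apply: eq_bigr => i _.
by rewrite inE ffunE /edge_at (tnth_nth fset0) /colored; case: eqP.
Qed.

(** Colored edges at [u] are pairwise adjacent, so [c] is injective on them and takes only the k
    values other than [None]. *)
Lemma star_bound {k} {s : seq edge} {c : coloring k s} (u : nat) :
  proper_coloring c ->
  (\sum_(i < size s) ((c i != None) && (u \in nth fset0 s i)) <= k)%N.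
Proof.
move=> proper_c; set S := [pred i | (c i != None) && (u \in nth fset0 s i)].
have -> : (\sum_(i < size s) ((c i != None) && (u \in nth fset0 s i)) = #|S|)%N.
  rewrite -sum1_card [RHS]big_mkcond; apply: eq_bigr => i _.
  by rewrite inE; case: (_ && _).
have inj_c : {in S &, injective c}.
  move=> i j /andP[ci ui] /andP[_ uj] eq_c; apply/eqP/negP => /negP neq_ij.
  suff adj_ij : adjacent_edges (edge_at i) (edge_at j).
    by have := proper_c i j neq_ij adj_ij ci; rewrite eq_c eqxx.
  rewrite /adjacent_edges /edge_at !(tnth_nth fset0) /=.
  by apply/fset0Pn; exists u; rewrite inE ui uj.
rewrite -(card_in_image inj_c).
have card_some : #|predC1 (None : option 'I_k)| = k.
  by rewrite cardC1 card_option card_ord.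
rewrite -[leqRHS]card_some.
by apply/subset_leq_card/fintype.subsetP => o /fintype.imageP[i Si ->];
  case/andP: Si.
Qed.

(** Adds up [star_bound] over [U]; an edge with both endpoints in [U] counts twice. *)
Lemma degree_bound {k} {A : online_algorithm k} {s : seq edge} (U : seq nat) :
  solves_tree A -> tree_input s ->
  (\sum_(i < size s) colored A s i * count (mem (nth fset0 s i)) U
    <= k * size U)%N.
Proof.
move=> solves_A tree_s; elim: U => [|u U IH] /=.
  by rewrite big1 // => i _; rewrite muln0.
rewrite mulnS (eq_bigr _ (fun i _ => mulnDr _ _ _)) big_split leq_add //=.
have := star_bound u (solves_A s tree_s); congr (_ <= _)%N.
apply: eq_bigr => i _.
by rewrite mulnb ffunE /edge_at (tnth_nth fset0).
Qed.

Lemma count_fset2_iota (x y m n : nat) : x != y ->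
  count (mem [fset x; y]%fset) (iota m n) =
  ((m <= x < m + n) + (m <= y < m + n))%N.
Proof.
move=> neq_xy; rewrite -!mem_iota -!count_uniq_mem ?iota_uniq //.
rewrite -count_predUI [X in (_ + X)%N](eq_count (a2 := pred0)) => [|z /=].
  by rewrite count_pred0 addn0; apply: eq_count => z; rewrite /= !inE.
by apply/negP => /andP[/eqP -> /eqP E]; rewrite E eqxx in neq_xy.
Qed.

(** * The adversary's trees and their optimal colorings *)

(* In the k-ary tree with edges {i / k, i+1}, if the edges i < a are those of
   the first d levels, then the edges i < level_up k a are those of the first
   d+1 levels. *)
Definition level_up (k a : nat) : nat := (k * a.+1)%N.

(* The edges i >= n give k extra children to each of the vertices 0, ..., a. *)
Definition trap_parent (k a i : nat) : nat :=
  let n := level_up k (level_up k a) in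
  if (i < n)%N then (i %/ k)%N else ((i - n) %/ k)%N.

Definition trap_size (k a : nat) : nat :=
  (level_up k (level_up k a) + level_up k a)%N.

Definition trap (k a : nat) : seq edge :=
  grown (trap_parent k a) (trap_size k a).

Lemma trap_parent_le k a i : (trap_parent k a i <= i)%N.
Proof.
rewrite /trap_parent; case: ifP => _; first exact: leq_div.
by rewrite (leq_trans (leq_div _ _)) // leq_subr.
Qed.

Lemma trap_tree k a : tree_input (trap k a).
Proof. by apply: grown_tree => i _; exact: trap_parent_le. Qed.

Lemma nth_trap k a i : (i < trap_size k a)%N ->
  nth fset0 (trap k a) i = [fset trap_parent k a i; i.+1]%fset.
Proof. exact: nth_grown. Qed.

Lemma count_trap {k a i} m n : (i < trap_size k a)%N ->
  count (mem (nth fset0 (trap k a) i)) (iota m n) =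
  ((m <= trap_parent k a i < m + n) + (m <= i.+1 < m + n))%N.
Proof.
move=> lt_i; rewrite nth_trap // count_fset2_iota //.
by rewrite neq_ltn ltnS trap_parent_le.
Qed.

Section TrapBounds.
Context (k a : nat) (A : online_algorithm k).
Hypotheses (k_gt0 : (0 < k)%N) (solves_A : solves_tree A).
Let a1 := level_up k a.
Let a2 := level_up k a1.

Lemma lt_level_up b : (b < level_up k b)%N.
Proof. exact: leq_pmull. Qed.

Lemma ltn_trap_parent {i} : (i < trap_size k a)%N ->
  (trap_parent k a i < a.+1)%N = (i < a1)%N || (a2 <= i)%N.
Proof.
rewrite /trap_size /trap_parent -/a1 -/a2 => lt_i.
have [lt_i2|le_i] := ltnP i a2;
  rewrite ltn_divLR // mulnC -/(level_up k a) -/a1.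
  by rewrite orbF.
by rewrite orbT; lia.
Qed.

Lemma trap_parent_lt {i} : (i < trap_size k a)%N ->
  (trap_parent k a i < a1.+1)%N.
Proof.
move=> lt_i; have [lt_i2|le_i] := ltnP i a2.
  by rewrite /trap_parent lt_i2 ltn_divLR // mulnC.
have : (trap_parent k a i < a.+1)%N by rewrite ltn_trap_parent // le_i orbT.
by have := lt_level_up a; rewrite -/a1; lia.
Qed.

(** Degree constraints at the vertices 0, ..., [a], of total capacity [k * a.+1 = a1]. The first [a]
    edges join two of these vertices and weigh double. *)
Lemma trap_inner_bound :
  (\sum_(i < trap_size k a) colored A (trap k a) i *
     ((i < a) + ((i < a1) || (a2 <= i))) <= a1)%N.
Proof.
have := degree_bound (iota 0 a.+1) solves_A (trap_tree k a).
rewrite size_iota size_grown; congr (_ <= _)%N; apply: eq_bigr => i _.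
move: (nat_of_ord i) (ltn_ord i) => {}i lt_i.
by rewrite count_trap // add0n /= ltn_trap_parent // ltnS addnC.
Qed.

(** Degree constraints at the vertices [a + 1], ..., [a1]. No edge joins two of them; those below
    [a1] end there, those from [a1] to [a2] start there. *)
Lemma trap_level_bound :
  (\sum_(i < trap_size k a) colored A (trap k a) i * (a <= i < a2)
     <= a2 - a1)%N.
Proof.
have lt_a1 := lt_level_up a; have lt_a2 := lt_level_up a1.
rewrite -/a2 in lt_a2.
have := degree_bound (iota a.+1 (a1 - a)) solves_A (trap_tree k a).
rewrite size_iota size_grown.
have -> : (k * (a1 - a) = a2 - a1)%N by rewrite /a2 /a1 /level_up -mulnBr subSS.
congr (_ <= _)%N; apply: eq_bigr => i _; congr (_ * _)%N.
move: (nat_of_ord i) (ltn_ord i) => {}i lt_i.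
rewrite count_trap // -/a1 addSn subnKC ?(ltnW lt_a1) //.
have := trap_parent_lt lt_i; have := ltn_trap_parent lt_i.
lia.
Qed.

(** From [a1] on, the edges to the children of one vertex form a block of k consecutive arrivals:
    before [a2] for vertices beyond [a], later for the others. So arrival times mod k tell siblings
    apart. *)
Lemma trap_parent_inj i j : (a1 <= i < trap_size k a)%N ->
  (a1 <= j < trap_size k a)%N -> i = j %[mod k] ->
  trap_parent k a i = trap_parent k a j -> i = j.
Proof.
move=> /andP[le_i lt_i] /andP[le_j lt_j] eq_mod eq_par.
have := ltn_trap_parent lt_i; rewrite eq_par (ltn_trap_parent lt_j).
rewrite !ltnNge le_i le_j /= => eq_range; move: eq_par.
rewrite /trap_parent -/a1 -/a2 !ltnNge -eq_range.
case: ifP eq_range => [/negbTE -> _|/negbFE le_j2]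
  => [eq_div|/esym le_i2 eq_div].
  by rewrite (divn_eq i k) (divn_eq j k) eq_mod eq_div.
rewrite le_j2 in le_i2; rewrite -(subnK le_i2) -(subnK le_j2); congr (_ + _)%N.
rewrite (divn_eq (i - a2) k) (divn_eq (j - a2) k) eq_div; congr (_ + _)%N.
by apply/eqP; rewrite -(eqn_modDr a2) !subnK //; exact/eqP.
Qed.

(* The children of the vertices beyond a are leaves of the whole tree, and so
   are the endpoints of the edges that arrive last: an optimal coloring only
   rejects the first a1 edges. *)
Lemma OPT_trap : (a2 <= OPT k (trap k a))%N.
Proof.
have size_trap : size (trap k a) = trap_size k a by exact: size_grown.
pose c : coloring k (trap k a) :=
  [ffun i : 'I_(size (trap k a)) => if (i < a1)%N then None
             else Some (Ordinal (ltn_pmod (i : nat) k_gt0))].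
have proper_c : proper_coloring c.
  move=> i j; rewrite -val_eqE /= => neq_ij + ci; apply: contraTneq => eq_c.
  move: eq_c ci; rewrite !ffunE.
  case: (ltnP i a1) => // le_i; case: (ltnP j a1) => // le_j [eq_mod] _.
  have lt_i : (i < trap_size k a)%N by rewrite -size_trap.
  have lt_j : (j < trap_size k a)%N by rewrite -size_trap.
  have neq_par : trap_parent k a i != trap_parent k a j.
    by apply: contraNneq neq_ij => /trap_parent_inj ->; rewrite ?le_i ?le_j.
  rewrite /adjacent_edges /edge_at !(tnth_nth fset0) /= !nth_trap //.
  (* Parents are at most [a1] and children exceed [a1], so distinct parents and distinct children
     make the edges disjoint. *)
  have := trap_parent_lt lt_i; have := trap_parent_lt lt_j.
  rewrite negbK => par_lt_j par_lt_i; apply/eqP/fsetP => x; rewrite !inE.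
  move: (nat_of_ord i) (nat_of_ord j) neq_ij le_i le_j
    neq_par par_lt_i par_lt_j.
  by lia.
have -> : a2 = num_colored c.
  transitivity (\sum_(i < trap_size k a) (a1 <= i))%N.
    rewrite -(big_mkord xpredT (fun i => nat_of_bool (a1 <= i)%N)).
    rewrite (big_cat_nat (n := a1)) //= ?leq_addl // big_nat_cond big1.
      rewrite big_nat_cond (eq_bigr (fun=> 1%N)).
        by rewrite -big_nat_cond sum_nat_const_nat muln1 addnK.
      by move=> i /andP[/andP[->]].
    by move=> i; rewrite andbT /= ltnNge => /negbTE ->.
  rewrite -size_trap /num_colored -sum1_card [RHS]big_mkcond.
  by apply: eq_bigr => i _; rewrite inE ffunE; case: ltnP.
by rewrite /OPT; apply: leq_bigmax_cond; exact/asboolP.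
Qed.
End TrapBounds.

(** * Expectations of weighted counts of events *)

Section Counting.
Local Open Scope classical_set_scope.
Context {R : realType} {d : measure_display} {T : measurableType d}.
Context (P : probability T R).

Lemma expectation_count (E : nat -> T -> bool) (wt : nat -> nat) (n : nat) :
  (forall i, measurable [set t | E i t]) ->
  ('E_P[fun t => (\sum_(i < n) E i t * wt i)%N%:R] =
   (\sum_(i < n) fine (P [set t | E i t]) * (wt i)%:R)%R%:E)%E.
Proof.
move=> mE; rewrite unlock.
under eq_integral => t _.
  rewrite natr_sum -sumEFin.
  under eq_bigr => i _.
    rewrite natrM mulrC EFinM.
    have -> : (E i t)%:R = \1_[set t | E i t] t :> R.
      rewrite indicE; congr (nat_of_bool _)%:R.
      by apply/idP/idP; rewrite in_setE.
    over.
  over.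
have mI (i : nat) : measurable_fun setT (\1_[set t | E i t] : T -> R).
  exact: measurable_indic.
rewrite ge0_integral_sum //; last first.
  by move=> i; apply: measurable_funeM; exact/measurable_EFinP/mI.
rewrite -sumEFin; apply: eq_bigr => i _.
rewrite ge0_integralZl_EFin //; last exact/measurable_EFinP/mI.
rewrite integral_indic // setIT mulrC EFinM fineK //.
exact: fin_num_measure.
Qed.

Lemma expected_count_le (E : nat -> T -> bool) (wt : nat -> nat) (n c : nat) :
  (forall i, measurable [set t | E i t]) ->
  (forall t, (\sum_(i < n) E i t * wt i <= c)%N) ->
  \sum_(i < n) fine (P [set t | E i t]) * (wt i)%:R <= c%:R.
Proof.
move=> mE le_c; rewrite -lee_fin -expectation_count // -(expectation_cst P).
apply: expectation_le => //.
- under eq_fun do rewrite natr_sum.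
  apply: measurable_sum => i.
  under eq_fun => t.
    rewrite natrM.
    have -> : (E i t)%:R = \1_[set t | E i t] t :> R.
      rewrite indicE; congr (nat_of_bool _)%:R.
      by apply/idP/idP; rewrite in_setE.
    over.
  by apply: measurable_funM => //; exact: measurable_indic.
- by apply: aeW => t; rewrite ler_nat.
Qed.
End Counting.

(** * The contradictory recurrences *)

Section FibonacciGrowth.
Context {R : realType}.

(* Normalized by powers of 2, the potential Z (d+1) / 2^(d+1) + Z d / 2^(d+1)
   increases by at least a constant at each step, although it is negative. *)
Lemma no_fibonacci_growth (Z a : nat -> R) (e b : R) : 0 < e ->
  (forall d, 2 ^+ d <= a d.+1) ->
  (forall d, Z d.+2 <= Z d) ->
  (forall d, Z d.+1 + Z d + e * a d.+2 - b <= Z d.+2) -> False.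
Proof.
move=> e_gt0 a_ge Z_le Z_ge.
have a_ge' d : e * 2 ^+ d.+1 <= e * a d.+2 by rewrite ler_pM2l.
have [m m_gt] : exists m, forall d, (m <= d)%N -> b <= e * 2 ^+ d.
  have [m m_gt] : exists m : nat, `|b| / e < m%:R.
    by exists (Num.bound (`|b| / e)); rewrite archi_boundP // divr_ge0 // ltW.
  exists m => d le_md; apply: (le_trans (ler_norm b)).
  rewrite mulrC -ler_pdivrMr //; apply: (le_trans (ltW m_gt)).
  by rewrite -natrX ler_nat (leq_trans le_md) // ltnW // ltn_expl.
(* Chaining the two hypotheses cancels [Z d] and leaves [Z d.+1 <= b - e * a d.+2]. *)
have Z_le0 d : (m <= d)%N -> Z d.+1 <= 0.
  move=> le_md; have := m_gt d le_md; have := Z_ge d; have := Z_le d.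
  have : 0 <= e * 2 ^+ d by rewrite mulr_ge0 ?exprn_ge0 // ltW.
  by have := a_ge' d; rewrite exprS; lra.
pose Q d := (2 * Z (m + d).+2 + 2 * Z (m + d).+1) / 2 ^+ (m + d).+2.
have Q_le0 d : Q d <= 0.
  rewrite /Q pmulr_lle0 ?invr_gt0 ?exprn_gt0 //.
  have := Z_le0 (m + d)%N (leq_addr _ _).
  by have := Z_le0 (m + d).+1 (leqW (leq_addr _ _)); lra.
have Q_step d : Q d + e / 2 <= Q d.+1.
  have pow_gt0 : 0 < 2 ^+ (m + d) :> R by rewrite exprn_gt0.
  rewrite /Q addnS -subr_ge0.
  set x := 2 ^+ (m + d) in pow_gt0 *.
  have -> : 2 ^+ (m + d).+3 = 8 * x by rewrite !exprS -/x; ring.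
  have -> : 2 ^+ (m + d).+2 = 4 * x by rewrite !exprS -/x; ring.
  have -> : (2 * Z (m + d).+3 + 2 * Z (m + d).+2) / (8 * x) -
     ((2 * Z (m + d).+2 + 2 * Z (m + d).+1) / (4 * x) + e / 2) =
     (Z (m + d).+3 - Z (m + d).+2 - 2 * Z (m + d).+1 - 2 * e * x) / (4 * x).
    by field; rewrite gt_eqF.
  apply: divr_ge0; last lra.
  (* The numerator is at least [4 * e * x - b - 2 * e * x], as [Z (m + d).+1 <= 0], and
     [b <= e * x]. *)
  have := Z_ge (m + d).+1; have := a_ge' (m + d).+1.
  have := m_gt (m + d)%N (leq_addr _ _).
  have := Z_le0 (m + d)%N (leq_addr _ _).
  have : 0 < e * x by rewrite mulr_gt0.
  by rewrite !exprS -/x; lra.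
have Q_lin d : Q 0 + d%:R * (e / 2) <= Q d.
  elim: d => [|d IH]; first by rewrite mul0r addr0.
  by have := Q_step d; rewrite -[d.+1%:R]natr1 mulrDl; lra.
pose n := Num.bound (- Q 0 / (e / 2)).
have : - Q 0 / (e / 2) < n%:R.
  by rewrite archi_boundP // divr_ge0 ?oppr_ge0 // ltW // divr_gt0.
rewrite ltr_pdivrMr ?divr_gt0 //.
by have := Q_lin n; have := Q_le0 n; lra.
Qed.
End FibonacciGrowth.

(** * Expected gains on the k-ary tree *)

Fixpoint level_end (k d : nat) : nat :=
  if d is d'.+1 then level_up k (level_end k d') else 0%N.

(** Doubling per level outpaces the Fibonacci numbers. *)
Lemma level_end_ge (k d : nat) : (2 <= k)%N -> (2 ^ d <= level_end k d.+1)%N.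
Proof.
move=> k_ge2; elim: d => [|d IH]; first by rewrite /= /level_up muln1 ltnW.
rewrite expnS (leq_trans (leq_mul k_ge2 IH)) // [leqRHS]/= /level_up.
by rewrite leq_mul.
Qed.

Section Adversary.
Local Open Scope classical_set_scope.
Context {R : realType} {k : nat} (A : randomized_tree_algorithm R k).
Hypothesis k_gt0 : (0 < k)%N.

Let up := level_up k.

Definition color_prob (s : seq edge) (i : nat) : R :=
  fine (rand_prob A [set w : rand_space A | colored (rand_alg w) s i]).

Lemma measurable_colored (s : seq edge) (i : nat) :
  measurable [set w : rand_space A | colored (rand_alg w) s i].
Proof.
have -> : [set w : rand_space A | colored (rand_alg w) s i] =
    ~` [set w : rand_space A | rand_alg w (take i s) (nth fset0 s i) = None].
  by apply/seteqP; split=> w /= /eqP.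
by apply: measurableC; exact: rand_alg_measurable.
Qed.

Lemma expected_coloredE (s : seq edge) :
  expected_colored A s = (\sum_(i < size s) color_prob s i)%:E.
Proof.
have := expectation_count (rand_prob A)
  (fun i (w : rand_space A) => colored (rand_alg w) s i)
  (fun=> 1%N) (size s) (measurable_colored s).
rewrite (eq_bigr _ (fun i _ => mulr1 _)) => <-.
rewrite /expected_colored; congr expectation; apply/funext => w.
by rewrite num_colored_run; under [in RHS]eq_bigr do rewrite muln1.
Qed.

Definition tree_prob (i : nat) : R := color_prob (grown (divn^~ k) i.+1) i.

(** Decisions depend only on the edges seen so far, and before its extra leaves every trap agrees
    with the k-ary tree. Hence all stopping levels share the same probabilities. *)
Lemma color_prob_trap (a i : nat) : (i < up (up a))%N ->
  color_prob (trap k a) i = tree_prob i.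
Proof.
move=> lt_i; rewrite /tree_prob /color_prob /colored.
have lt_i' : (i < trap_size k a)%N by rewrite (leq_trans lt_i) // leq_addr.
rewrite nth_trap // nth_grown // !take_grown ?(ltnW lt_i') //.
have -> : grown (trap_parent k a) i = grown (divn^~ k) i.
  by apply: eq_grown => j lt_j; rewrite /trap_parent (ltn_trans lt_j).
by rewrite /trap_parent lt_i.
Qed.

(** At [n = level_end k d], which is a d, this is S d. *)
Definition tree_gain (n : nat) : R := \sum_(i < n) tree_prob i.

Lemma tree_gain_trap (a n : nat) : (n <= up (up a))%N ->
  tree_gain n = \sum_(i < trap_size k a) color_prob (trap k a) i * (i < n)%N%:R.
Proof.
move=> le_n; have le_size : (n <= trap_size k a)%N.
  by rewrite (leq_trans le_n) // leq_addr.
rewrite /tree_gain (big_ord_widen _ tree_prob le_size) big_mkcond.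
apply: eq_bigr => i _; case: ifP => [lt_i|]; last by rewrite mulr0.
by rewrite mulr1 color_prob_trap // (leq_trans lt_i).
Qed.

Lemma color_prob_bound {a c : nat} {wt : nat -> nat} :
  (forall w : rand_space A, (\sum_(i < trap_size k a)
     colored (rand_alg w) (trap k a) i * wt i <= c)%N) ->
  \sum_(i < trap_size k a) color_prob (trap k a) i * (wt i)%:R <= c%:R.
Proof.
exact: (expected_count_le (rand_prob A)
  (fun i w => colored (rand_alg w) (trap k a) i)) (measurable_colored _).
Qed.

(** By [trap_inner_bound], the extra leaves add at most [(up a)%:R - tree_gain (up a) - tree_gain
    a]. *)
Lemma expected_colored_trap (a : nat) :
  (expected_colored A (trap k a) <=
   (tree_gain (up (up a)) - tree_gain (up a) - tree_gain a + (up a)%:R)%:E)%E.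
Proof.
set a1 := up a; set a2 := up a1.
have lt_a1 : (a < a1)%N := lt_level_up _ k_gt0 a.
have lt_a2 : (a1 < a2)%N := lt_level_up _ k_gt0 a1.
have := color_prob_bound (wt := fun i => ((i < a) + ((i < a1) || (a2 <= i)))%N)
  (fun w => trap_inner_bound k a _ k_gt0 (@rand_alg_solves _ _ A w)).
rewrite -/a1 -/a2 expected_coloredE lee_fin size_grown => bound.
have lt_a := ltn_trans lt_a1 lt_a2.
rewrite (tree_gain_trap a a2) // (tree_gain_trap a a1 (ltnW lt_a2)).
rewrite (tree_gain_trap a a (ltnW lt_a)).
rewrite addrC -lerBlDr; apply: le_trans bound.
rewrite le_eqVlt; apply/orP; left.
rewrite -!sumrB; apply/eqP/eq_bigr => i _.
have : (1 + (i < a) + (i < a1) =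
    (i < a2) + ((i < a) + ((i < a1) || (a2 <= i))))%N.
  by move: (nat_of_ord i) => j; lia.
by move=> /(congr1 (fun n => n%:R : R)); rewrite !natrD; nra.
Qed.

Lemma tree_gain_two_levels (a : nat) :
  tree_gain (up (up a)) - tree_gain a <= (up (up a))%:R - (up a)%:R.
Proof.
set a1 := up a; set a2 := up a1.
have lt_a1 : (a < a1)%N := lt_level_up _ k_gt0 a.
have lt_a2 : (a1 < a2)%N := lt_level_up _ k_gt0 a1.
have := color_prob_bound (wt := fun i => nat_of_bool (a <= i < a2)%N)
  (fun w => trap_level_bound k a _ k_gt0 (@rand_alg_solves _ _ A w)).
rewrite -/a1 -/a2 natrB ?(ltnW lt_a2) //; apply: le_trans.
rewrite (tree_gain_trap a a2) //.
rewrite (tree_gain_trap a a (ltnW (ltn_trans lt_a1 lt_a2))).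
rewrite -sumrB ler_sum // => i _; rewrite -mulrBr.
suff -> : (i < a2)%:R - (i < a)%:R = (a <= i < a2)%:R :> R by [].
have : ((i < a2) = (i < a) + (a <= i < a2) :> nat)%N.
  by move: (nat_of_ord i) => j; lia.
by move=> /(congr1 (fun n => n%:R : R)); rewrite natrD; lra.
Qed.

Lemma competitive_trap {C : R} : 0 <= C -> competitive A C ->
  exists b, forall a, C * (up (up a))%:R - b <=
    tree_gain (up (up a)) - tree_gain (up a) - tree_gain a + (up a)%:R.
Proof.
move=> C_ge0 [b comp_A]; exists b => a; rewrite -lee_fin.
apply: le_trans (expected_colored_trap a).
apply: le_trans (comp_A _ (trap_tree k a)).
by rewrite lee_fin lerD2r ler_wpM2l // ler_nat OPT_trap.
Qed.

End Adversary.

Theorem theorem5 (R : realType) (k : nat) (hk : (2 <= k)%N)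
    (RAND : randomized_tree_algorithm R k) :
  (competitive_ratio RAND <= (k%:R / (k.+1)%:R)%:E)%E.
Proof.
have k_gt0 : (0 < k)%N by exact: ltnW.
have k1_gt0 : 0 < k.+1%:R :> R by rewrite ltr0n.
set alpha : R := k%:R / k.+1%:R.
have alphaE : alpha * k.+1%:R = k%:R by rewrite /alpha mulfVK // gt_eqF.
apply: ge_ereal_sup => _ [C comp_C <-].
rewrite lee_fin leNgt; apply/negP => lt_C.
have alpha_ge0 : 0 <= alpha by rewrite divr_ge0.
have [b bound] :=
  competitive_trap RAND k_gt0 (le_trans alpha_ge0 (ltW lt_C)) comp_C.
pose a := level_end k.
have aS d : (a d.+1)%:R = k%:R * ((a d)%:R + 1) :> R.
  by rewrite natr1 -natrM.
(* This identity singles out [alpha]: it cancels the terms linear in [a] in both recurrences. *)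
have alpha_level d : (a d.+1)%:R = alpha * (a d.+1)%:R + alpha * ((a d)%:R + 1).
  by rewrite aS -[X in X * _ = _]alphaE -natr1; ring.
pose Z d := tree_gain RAND (a d) - alpha * (a d)%:R.
(* The [alpha] added to [b] is the constant term of [alpha_level]. *)
apply: (@no_fibonacci_growth R Z (fun d => (a d)%:R) (C - alpha) (b + alpha)).
- by rewrite subr_gt0.
- by move=> d; rewrite -natrX ler_nat level_end_ge.
(* Two consecutive levels give [a d.+2 - a d.+1 = alpha * (a d.+2 - a d)]. *)
- move=> d; have := tree_gain_two_levels RAND k_gt0 (a d).
  rewrite -/(a d.+1) -/(a d.+2) /Z.
  have := alpha_level d; have := alpha_level d.+1; lra.
- move=> d; have := bound (a d).
  rewrite -/(a d.+1) -/(a d.+2) /Z.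
  have := alpha_level d; lra.
Qed.
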